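(* Let $F$ be a field with a (surjective) valuation $v:F^\times\to\Gamma$, residue field $k$, and group of units $U=\{x\in F^\times:v(x)=0\}$. Let $\rho:R_F\to R_k$ be any ring homomorphism satisfying $\rho(\langle u\rangle)=\langle\bar u\rangle$ for all $u\in U$. Then $\rho$ induces an $R_F$-module structure on $\mathcal{RP}(k)$ (and hence on its quotient $\widehat{\mathcal{RP}}(k)$), and there is a surjective homomorphism of $R_F$-modules $S=S_\rho:\mathcal{RP}(F)\to\widehat{\mathcal{RP}}(k)$ determined by $$[a]\mapsto\begin{cases}[\bar a], & a\in U,\\ \epsilon_v(a)\,C_k, & a\notin U,\end{cases}$$ where $\epsilon_v(a)=\mathrm{sign}(v(a))\in\{\pm1\}$ for $v(a)\ne0$.
   Context: For a field $F$ let $G_F=F^\times/(F^\times)^2$, let $\langle x\rangle\in G_F$ be the square class of $x\in F^\times$, $R_F=\mathbb{Z}[G_F]$, and $\langle\langle x\rangle\rangle=\langle x\rangle-1\in R_F$. Refined pre-Bloch group: if $|F|\ge 4$, $\mathcal{RP}(F)$ is the $R_F$-module with generators $[x]$, $x\in F^\times$, subject to $[1]=0$ and, for all $x,y\in F^\times\setminus\{1\}$, $0=[x]-[y]+\langle x\rangle[y/x]-\langle x^{-1}-1\rangle\left[\frac{1-x^{-1}}{1-y^{-1}}\right]+\langle 1-x\rangle\left[\frac{1-x}{1-y}\right]$. $\mathcal{RP}(\mathbb{F}_2)$ is an additive group of order $3$ with distinguished generator $C_{\mathbb{F}_2}$ (and $[1]=0$). $\mathcal{RP}(\mathbb{F}_3)$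 is the $R_{\mathbb{F}_3}$-module generated by $[-1]$ with the single relation $2([-1]+\langle -1\rangle[-1])=0$ (and $[1]=0$). For $x\in F^\times$: $\psi_1(x)=[x]+\langle -1\rangle[x^{-1}]$; $\psi_2(x)=\langle 1-x\rangle(\langle x\rangle[x]+[x^{-1}])$ if $x\neq 1$ and $\psi_2(1)=0$. (For $\mathbb{F}_2$, $\psi_1(1)=\psi_2(1)=0$; for $\mathbb{F}_3$, $\psi_1(-1)=\psi_2(-1)=[-1]+\langle -1\rangle[-1]$.) For $i=1,2$, $\mathcal{K}^{(i)}_F$ is the $R_F$-submodule of $\mathcal{RP}(F)$ generated by all $\psi_i(x)$, $x\in F^\times$, and $\widehat{\mathcal{RP}}(F)=\mathcal{RP}(F)/(\mathcal{K}^{(1)}_F+\mathcal{K}^{(2)}_F)$. For $|F|\ge4$ the element $C_F:=[x]+\langle -1\rangle[1-x]+\langle\langle 1-x\rangle\rangle\psi_1(x)\in\mathcal{RP}(F)$ does not depend on $x\in F\setminus\{0,1\}$; $C_{\mathbb{F}_2}$ is the distinguished generator and $C_{\mathbb{F}_3}=\psi_1(-1)$. Valuations take values in an ordered abelian group $\Gamma$ (written additively) and are always assumed surjective; $\bar a$ denotes the image in $k$ of an element $a$ of the valuation ring.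
   Formalization: When F has two elements, [1]=0 does not generate RP(F), so the stated values do not determine S (S and -S both satisfy them); for |F|=2 only, the prescription is completed by requiring that S sends C_F to C_k. *)

(* Defs.v *)
From HB Require Import structures.
From mathcomp Require Import all_boot all_order all_algebra finmap.
From mathcomp Require Import boolp classical_sets functions cardinality.
From mathcomp Require Import monalg.

Set Implicit Arguments.
Unset Strict Implicit.
Unset Printing Implicit Defensive.

Import Order.TTheory GRing.Theory Num.Theory.
Local Open Scope classical_set_scope.
Local Open Scope ring_scope.
Local Open Scope quotient_scope.

(* The integral group ring Z[G]. [monalg] only makes [{malg R[K]}] a ring when
   [1 = x * y] forces [x = y = 1], hence the alias with its own product. *)
Definition group_ring (G : groupType) : Type := {malg int[G]}.

Section GroupRing.
Variable G : groupType.
Local Notation ZG := (group_ring G).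

HB.instance Definition _ := GRing.Zmodule.copy ZG {malg int[G]}.

Definition gr_in (g : G) : ZG := << 1 *g g >>.

Definition gr_mul (a b : ZG) : ZG :=
  \sum_(g <- msupp a) \sum_(h <- msupp b) << a@_g * b@_h *g (g * h)%g >>.

Lemma gr_mulw (d1 d2 : {fset G}) (a b : ZG) :
  (msupp a `<=` d1)%fset -> (msupp b `<=` d2)%fset ->
  gr_mul a b = \sum_(g <- d1) \sum_(h <- d2) << a@_g * b@_h *g (g * h)%g >>.
Proof.
move=> le_d1 le_d2; rewrite /gr_mul (big_fset_incl _ le_d1) /=.
  apply/eq_bigr=> k1 _; apply/big_fset_incl => // k _ /mcoeff_outdom ->.
  by rewrite mulr0 monalgU0.
move=> k _ /mcoeff_outdom ak.
by rewrite big1 => // k' _; rewrite ak mul0r monalgU0.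
Qed.

Lemma gr_mulDl : left_distributive gr_mul +%R.
Proof.
move=> a b c.
rewrite (gr_mulw (msuppD_le _ _) (fsubset_refl _)).
rewrite [X in _ = X + _](gr_mulw (fsubsetUl _ (msupp b)) (fsubset_refl _)).
rewrite [X in _ = _ + X](gr_mulw (fsubsetUr (msupp a) _) (fsubset_refl _)).
rewrite -big_split /=; apply/eq_bigr=> k1 _.
rewrite -big_split /=; apply/eq_bigr=> k2 _.
by rewrite mcoeffD mulrDl monalgUD.
Qed.

Lemma gr_mulDr : right_distributive gr_mul +%R.
Proof.
move=> c a b.
rewrite (gr_mulw (fsubset_refl _) (msuppD_le _ _)).
rewrite [X in _ = X + _](gr_mulw (fsubset_refl _) (fsubsetUl _ (msupp b))).
rewrite [X in _ = _ + X](gr_mulw (fsubset_refl _) (fsubsetUr (msupp a) _)).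
rewrite -big_split /=; apply/eq_bigr=> k1 _.
rewrite -big_split /=; apply/eq_bigr=> k2 _.
by rewrite mcoeffD mulrDr monalgUD.
Qed.

Lemma gr_mulUU (x y : int) (g h : G) :
  gr_mul << x *g g >> << y *g h >> = << x * y *g (g * h)%g >>.
Proof. by rewrite (gr_mulw msuppU_le msuppU_le) !big_seq_fset1 !mcoeffUU. Qed.

Lemma gr_mul0r : right_zero 0 gr_mul.
Proof. by move=> a; apply: (addIr (gr_mul a 0)); rewrite -gr_mulDr !add0r. Qed.

Lemma gr_mul0l : left_zero 0 gr_mul.
Proof. by move=> a; apply: (addIr (gr_mul 0 a)); rewrite -gr_mulDl !add0r. Qed.

Lemma gr_ind (P : ZG -> Prop) :
  P 0 -> (forall a b, P a -> P b -> P (a + b)) ->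
  (forall (x : int) g, P << x *g g >>) -> forall a, P a.
Proof.
by move=> P0 PD PU a; rewrite [a]monalgE; elim/big_ind: _ => // g _; apply: PU.
Qed.

Lemma gr_mulA : associative gr_mul.
Proof.
move=> a b c; elim/gr_ind: a => [|a1 a2 IH1 IH2|x g].
- by rewrite !gr_mul0l.
- by rewrite !gr_mulDl IH1 IH2.
elim/gr_ind: b => [|b1 b2 IH1 IH2|y h].
- by rewrite gr_mul0l gr_mul0r gr_mul0l.
- by rewrite gr_mulDl !gr_mulDr gr_mulDl IH1 IH2.
elim/gr_ind: c => [|c1 c2 IH1 IH2|z l].
- by rewrite !gr_mul0r.
- by rewrite !gr_mulDr IH1 IH2.
by rewrite !gr_mulUU mulrA mulgA.
Qed.

Lemma gr_mul1l : left_id (gr_in 1%g) gr_mul.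
Proof.
elim/gr_ind => [|a b IHa IHb|x g]; first by rewrite gr_mul0r.
  by rewrite gr_mulDr IHa IHb.
by rewrite gr_mulUU mul1r mul1g.
Qed.

Lemma gr_mul1r : right_id (gr_in 1%g) gr_mul.
Proof.
elim/gr_ind => [|a b IHa IHb|x g]; first by rewrite gr_mul0l.
  by rewrite gr_mulDl IHa IHb.
by rewrite gr_mulUU mulr1 mulg1.
Qed.

Lemma gr_oner_neq0 : gr_in 1%g != 0.
Proof. by rewrite monalgU_eq0 oner_eq0. Qed.

HB.instance Definition _ := GRing.Zmodule_isNzRing.Build ZG
  gr_mulA gr_mul1l gr_mul1r gr_mulDl gr_mulDr gr_oner_neq0.

End GroupRing.

Record funit (F : fieldType) := FUnit { fval : F; _ : fval != 0 }.

Section Units.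
Variable F : fieldType.

HB.instance Definition _ := [isSub for @fval F].
HB.instance Definition _ := [Choice of funit F by <:].

Lemma fval_neq0 (u : funit F) : fval u != 0. Proof. exact: valP u. Qed.

Definition funit1 : funit F := FUnit (oner_neq0 F).
Definition funit_mul (u w : funit F) : funit F :=
  FUnit (mulf_neq0 (fval_neq0 u) (fval_neq0 w)).
Lemma funitV_proof (u : funit F) : (fval u)^-1 != 0.
Proof. by rewrite invr_eq0 fval_neq0. Qed.
Definition funit_inv (u : funit F) : funit F := FUnit (funitV_proof u).

Lemma funit_mulA : associative funit_mul.
Proof. by move=> u w t; apply: val_inj; rewrite /= mulrA. Qed.
Lemma funit_mul1l : left_id funit1 funit_mul.
Proof. by move=> u; apply: val_inj; rewrite /= mul1r. Qed.
Lemma funit_mul1r : right_id funit1 funit_mul.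
Proof. by move=> u; apply: val_inj; rewrite /= mulr1. Qed.
Lemma funit_mulVl : left_inverse funit1 funit_inv funit_mul.
Proof. by move=> u; apply: val_inj; rewrite /= mulVf ?fval_neq0. Qed.
Lemma funit_mulVr : right_inverse funit1 funit_inv funit_mul.
Proof. by move=> u; apply: val_inj; rewrite /= mulfV ?fval_neq0. Qed.

HB.instance Definition _ := isGroup.Build (funit F)
  funit_mulA funit_mul1l funit_mul1r funit_mulVl funit_mulVr.

Lemma funitC (u w : funit F) : (u * w = w * u)%g.
Proof. by apply: val_inj; rewrite /= mulrC. Qed.

(* Functions on F^* are extended to F below by their value at 1. *)
Definition to_unit (x : F) : funit F := insubd funit1 x.

(* G_F = F^* / (F^* )^2 *)
Definition sq_equiv (u w : funit F) : bool :=
  `[< exists t : funit F, u = (w * t ^+ 2)%g >].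

Lemma sq_equiv_equiv : equiv_class_of sq_equiv.
Proof.
split=> [u|u w|u w t].
- by apply/asboolP; exists 1%g; rewrite expg1n mulg1.
- suff sym a b : sq_equiv a b -> sq_equiv b a by apply/idP/idP; apply: sym.
  move=> /asboolP [t ->]; apply/asboolP; exists (t^-1)%g.
  by rewrite expVgn mulgK.
- move=> /asboolP [a ->] /asboolP [b ->]; apply/asboolP; exists (b * a)%g.
  by rewrite expgMn ?mulgA //; exact: funitC.
Qed.

Canonical sq_equiv_equivRel := EquivRelPack sq_equiv_equiv.

Definition sqclass := {eq_quot sq_equiv}.

HB.instance Definition _ := EqQuotient.on sqclass.
HB.instance Definition _ := Choice.on sqclass.

Definition to_sqclass (u : funit F) : sqclass := \pi_sqclass u.

Lemma to_sqclassK (a : sqclass) : to_sqclass (repr a) = a.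
Proof. exact: reprK. Qed.

Definition sqclass1 : sqclass := to_sqclass 1%g.
Definition sqclass_mul (a b : sqclass) : sqclass := to_sqclass (repr a * repr b)%g.
Definition sqclass_inv (a : sqclass) : sqclass := to_sqclass (repr a)^-1%g.

Lemma sqclassP (u w : funit F) :
  reflect (exists t : funit F, u = (w * t ^+ 2)%g)
          (to_sqclass u == to_sqclass w).
Proof. by rewrite /to_sqclass eqmodE; apply: asboolP. Qed.

Lemma sqclass_piM u w : sqclass_mul (to_sqclass u) (to_sqclass w) = to_sqclass (u * w)%g.
Proof.
have /esym/eqP/sqclassP [s us] : to_sqclass u = to_sqclass (repr (to_sqclass u)).
  by rewrite to_sqclassK.
have /esym/eqP/sqclassP [t wt] : to_sqclass w = to_sqclass (repr (to_sqclass w)).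
  by rewrite to_sqclassK.
apply/eqP/sqclassP; exists (s * t)%g; rewrite us wt expgMn; last exact: funitC.
move: (s ^+ 2)%g (t ^+ 2)%g => a b.
by rewrite -!mulgA (mulgA a) (funitC a) -mulgA.
Qed.

Lemma sqclass_piV u : sqclass_inv (to_sqclass u) = to_sqclass (u^-1)%g.
Proof.
have /esym/eqP/sqclassP [s us] : to_sqclass u = to_sqclass (repr (to_sqclass u)).
  by rewrite to_sqclassK.
apply/eqP/sqclassP; exists (s^-1)%g.
by rewrite us invgM expVgn funitC.
Qed.

Lemma sqclass_mulA : associative sqclass_mul.
Proof.
move=> a b c; rewrite -[a]to_sqclassK -[b]to_sqclassK -[c]to_sqclassK.
by rewrite !sqclass_piM mulgA.
Qed.
Lemma sqclass_mul1l : left_id sqclass1 sqclass_mul.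
Proof. by move=> a; rewrite -[a]to_sqclassK sqclass_piM mul1g. Qed.
Lemma sqclass_mul1r : right_id sqclass1 sqclass_mul.
Proof. by move=> a; rewrite -[a]to_sqclassK sqclass_piM mulg1. Qed.
Lemma sqclass_mulVl : left_inverse sqclass1 sqclass_inv sqclass_mul.
Proof. by move=> a; rewrite -[a]to_sqclassK sqclass_piV sqclass_piM mulVg. Qed.
Lemma sqclass_mulVr : right_inverse sqclass1 sqclass_inv sqclass_mul.
Proof. by move=> a; rewrite -[a]to_sqclassK sqclass_piV sqclass_piM mulgV. Qed.

HB.instance Definition _ := isGroup.Build sqclass
  sqclass_mulA sqclass_mul1l sqclass_mul1r sqclass_mulVl sqclass_mulVr.

End Units.

Definition RF (F : fieldType) : nzRingType := group_ring (sqclass F).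

(* <x> *)
Definition sqc (F : fieldType) (x : F) : RF F :=
  gr_in (to_sqclass (to_unit x)).
(* <<x>> *)
Definition pfister (F : fieldType) (x : F) : RF F := sqc x - 1.

(* M / <A>, the quotient of a left module by the submodule generated by A. *)
Inductive span (R : nzRingType) (M : lmodType R) (A : set M) : set M :=
| span0 : span A 0
| span_lin (r : R) (x y : M) : A x -> span A y -> span A (r *: x + y).

Section Quotient.
Variables (R : nzRingType) (M : lmodType R) (A : set M).

Lemma spanD x y : span A x -> span A y -> span A (x + y).
Proof.
move=> Ax Ay; elim: Ax => [|r a b Aa _ IH]; first by rewrite add0r.
by rewrite -addrA; apply: span_lin.
Qed.

Lemma spanZ r x : span A x -> span A (r *: x).
Proof.
elim=> [|s a b Aa _ IH]; first by rewrite scaler0; apply: span0.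
by rewrite scalerDr scalerA; apply: span_lin.
Qed.

Lemma sub_span x : A x -> span A x.
Proof.
by move=> Ax; rewrite -[x]scale1r -[1 *: x]addr0; apply: span_lin => //; apply: span0.
Qed.

Definition span_pred (x : M) : bool := `[< span A x >].

Lemma span_zmod_closed : zmod_closed span_pred.
Proof.
split=> [|x y /asboolP Ax /asboolP Ay]; apply/asboolP; first exact: span0.
by rewrite -scaleN1r; apply: spanD => //; apply: spanZ.
Qed.

HB.instance Definition _ := GRing.isZmodClosed.Build M span_pred span_zmod_closed.

Definition span_closed := GRing.ZmodClosed.clone M span_pred _.

Definition quotmod : Type := {ideal_quot span_closed}.

HB.instance Definition _ := GRing.Zmodule.copy quotmod {ideal_quot span_closed}.

Definition qproj (x : M) : quotmod := \pi_{ideal_quot span_closed} x.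

Lemma qproj_zmod_morphism : zmod_morphism qproj.
Proof. by move=> x y; rewrite /qproj !piE. Qed.

HB.instance Definition _ :=
  GRing.isZmodMorphism.Build M quotmod qproj qproj_zmod_morphism.

Lemma qprojP x y : reflect (span A (x - y)) (qproj x == qproj y).
Proof. by rewrite /qproj eqmodE; apply: asboolP. Qed.

Lemma qproj_repr (q : quotmod) : qproj (repr (q : {ideal_quot span_closed})) = q.
Proof. exact: reprK. Qed.

Definition quotmod_scale (r : R) (q : quotmod) : quotmod :=
  qproj (r *: repr (q : {ideal_quot span_closed})).

Lemma quotmod_scale_proj r x : quotmod_scale r (qproj x) = qproj (r *: x).
Proof.
apply/eqP/qprojP; rewrite -scalerBr; apply: spanZ.
by apply/qprojP; rewrite qproj_repr.
Qed.

Lemma quotmod_scaleA a b q :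
  quotmod_scale a (quotmod_scale b q) = quotmod_scale (a * b) q.
Proof. by rewrite -[q]qproj_repr !quotmod_scale_proj scalerA. Qed.
Lemma quotmod_scale1 : left_id 1 quotmod_scale.
Proof. by move=> q; rewrite -[q]qproj_repr quotmod_scale_proj scale1r. Qed.
Lemma quotmod_scaleDr : right_distributive quotmod_scale +%R.
Proof.
move=> a q s; rewrite -[q]qproj_repr -[s]qproj_repr -raddfD /=.
by rewrite !quotmod_scale_proj scalerDr raddfD.
Qed.
Lemma quotmod_scaleDl q : {morph quotmod_scale^~ q : a b / a + b}.
Proof.
by move=> a b; rewrite -[q]qproj_repr !quotmod_scale_proj scalerDl raddfD.
Qed.

HB.instance Definition _ := GRing.Zmodule_isLmodule.Build R quotmod
  quotmod_scaleA quotmod_scale1 quotmod_scaleDr quotmod_scaleDl.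

Lemma qproj_scalable : scalable qproj.
Proof. by move=> r x; rewrite -quotmod_scale_proj. Qed.

HB.instance Definition _ :=
  GRing.isScalable.Build R M quotmod *:%R qproj qproj_scalable.

End Quotient.

(* M with scalars restricted along rho: r acts on m as rho r. *)
Definition restr_scalars (R S : nzRingType) (rho : {rmorphism R -> S})
  (M : lmodType S) : Type := M.

Section RestrScalars.
Variables (R S : nzRingType) (rho : {rmorphism R -> S}) (M : lmodType S).
Local Notation M_rho := (restr_scalars rho M).

HB.instance Definition _ := GRing.Zmodule.copy M_rho M.

Definition restr_scale (r : R) (m : M_rho) : M_rho := (rho r *: (m : M) : M).

Lemma restr_scaleA a b m :
  restr_scale a (restr_scale b m) = restr_scale (a * b) m.
Proof. by rewrite /restr_scale scalerA rmorphM. Qed.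
Lemma restr_scale1 : left_id 1 restr_scale.
Proof. by move=> m; rewrite /restr_scale rmorph1 scale1r. Qed.
Lemma restr_scaleDr : right_distributive restr_scale +%R.
Proof. by move=> a m n; rewrite /restr_scale scalerDr. Qed.
Lemma restr_scaleDl m : {morph restr_scale^~ m : a b / a + b}.
Proof. by move=> a b; rewrite /restr_scale rmorphD scalerDl. Qed.

HB.instance Definition _ := GRing.Zmodule_isLmodule.Build R M_rho
  restr_scaleA restr_scale1 restr_scaleDr restr_scaleDl.

End RestrScalars.

Definition has_card (F : fieldType) (n : nat) : bool :=
  ([set: F] #= `I_n)%card.

Section RefinedPreBloch.
Variable F : fieldType.

(* [Some x] is the generator [x]; [None] is an extra generator, which is the
   distinguished generator of RP(F_2) if |F| = 2 and is killed otherwise. *)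
Definition RP_free : lmodType (RF F) := {malg (RF F)[option (funit F)]}.
Definition RP_gen (x : F) : RP_free := << Some (to_unit x) >>.
Definition RP_genC : RP_free := << None >>.

Inductive RP_rel : set RP_free :=
| RP_rel_one : RP_rel (RP_gen 1)
| RP_rel_five (x y : F) of (`I_4 #<= [set: F])%card
    & x != 0 & x != 1 & y != 0 & y != 1 :
    RP_rel (RP_gen x - RP_gen y + sqc x *: RP_gen (y / x)
            - sqc (x^-1 - 1) *: RP_gen ((1 - x^-1) / (1 - y^-1))
            + sqc (1 - x) *: RP_gen ((1 - x) / (1 - y)))
| RP_rel_F3 of has_card F 3 :
    RP_rel ((RP_gen (- 1) + sqc (- 1) *: RP_gen (- 1)) *+ 2)
| RP_rel_F2 of has_card F 2 : RP_rel (RP_genC *+ 3)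
| RP_rel_noC of ~~ has_card F 2 : RP_rel RP_genC.

Definition RP : lmodType (RF F) := quotmod RP_rel.

Definition rp (x : F) : RP := qproj RP_rel (RP_gen x).

(* The same formulas give the stated values when |F| is 2 or 3. *)
Definition psi1 (x : F) : RP := rp x + sqc (- 1) *: rp x^-1.
Definition psi2 (x : F) : RP :=
  if x == 1 then 0 else sqc (1 - x) *: (sqc x *: rp x + rp x^-1).

Definition K1 : set RP := span [set psi1 x | x in [set x : F | x != 0]].
Definition K2 : set RP := span [set psi2 x | x in [set x : F | x != 0]].

Definition RPhat : lmodType (RF F) :=
  quotmod [set a + b | a in K1 & b in K2].
Definition RPhat_proj : {linear RP -> RPhat} :=
  qproj [set a + b | a in K1 & b in K2].

Definition RC_at (x : F) : RP :=
  rp x + sqc (- 1) *: rp (1 - x) + pfister (1 - x) *: psi1 x.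

(* C_F; if |F| >= 4, [RC_at x] is the same for all x other than 0 and 1. *)
Definition RC : RP :=
  if has_card F 2 then qproj RP_rel RP_genC
  else if has_card F 3 then psi1 (- 1)
  else RC_at (xget 0 [set x : F | x != 0 /\ x != 1]).

End RefinedPreBloch.

(* An ordered abelian group; the library has no such structure. *)
HB.mixin Record POrderedZmodule_isTotal G of Num.POrderedZmodule G := {
  ozmod_total : total (<=%R : rel G);
  ozmod_leD2l : forall z x y : G, x <= y -> z + x <= z + y
}.

#[short(type="orderedZmodType")]
HB.structure Definition OrderedZmodule :=
  { G of POrderedZmodule_isTotal G & Num.POrderedZmodule G }.

(* The value at 0 is irrelevant. *)
Record valuation (F : fieldType) (G : orderedZmodType) := Valuation {
  vfun :> F -> G;
  valuationM : forall x y, x != 0 -> y != 0 -> vfun (x * y) = vfun x + vfun y;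
  valuationD : forall x y, x != 0 -> y != 0 -> x + y != 0 ->
    Order.min (vfun x) (vfun y) <= vfun (x + y);
  valuation_surj : forall g : G, exists2 x, x != 0 & vfun x = g
}.

Section Valuation.
Variables (F : fieldType) (G : orderedZmodType) (v : valuation F G).

Lemma valuation1 : v 1 = 0.
Proof.
by apply: (addrI (v 1)); rewrite -valuationM ?oner_neq0// mulr1 addr0.
Qed.

Lemma valuationV x : x != 0 -> v x^-1 = - v x.
Proof.
move=> x0; apply: (addrI (v x)).
by rewrite -valuationM ?invr_eq0// mulfV// valuation1 subrr.
Qed.

Lemma valuationN x : v (- x) = v x.
Proof.
have [->|x0] := eqVneq x 0; first by rewrite oppr0.
rewrite -mulN1r valuationM ?oppr_eq0 ?oner_neq0//.
suff -> : v (- 1) = 0 by rewrite add0r.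
have vv : v (-1) + v (-1) = 0.
  by rewrite -valuationM ?oppr_eq0 ?oner_neq0// mulrNN mulr1 valuation1.
apply/eqP; rewrite eq_le; apply/andP.
case/orP: (ozmod_total (v (-1)) 0) => h; split=> //.
- by have := ozmod_leD2l (v (-1)) _ _ h; rewrite vv addr0.
- by have := ozmod_leD2l (v (-1)) _ _ h; rewrite vv addr0.
Qed.

Definition val_ring_pred : {pred F} := fun x => (x == 0) || (0 <= v x).

Lemma val_ring_subring_closed : subring_closed val_ring_pred.
Proof.
split=> [|x y|x y]; rewrite /val_ring_pred !unfold_in.
- by rewrite valuation1 lexx orbT.
- have [->|x0] := eqVneq x 0; first by rewrite sub0r oppr_eq0 valuationN.
  have [->|y0] := eqVneq y 0; first by rewrite subr0 (negbTE x0).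
  have [//|xy0 /= vx vy] := eqVneq (x - y) 0.
  apply: le_trans (valuationD v x0 _ xy0); last by rewrite oppr_eq0.
  by rewrite valuationN /Order.min; case: ifP.
- have [->|x0] := eqVneq x 0; first by rewrite mul0r eqxx.
  have [->|y0 /= vx vy] := eqVneq y 0; first by rewrite mulr0 eqxx.
  rewrite valuationM// (le_trans vx) ?orbT//.
  by have := ozmod_leD2l (v x) _ _ vy; rewrite addr0.
Qed.

HB.instance Definition _ :=
  GRing.isSubringClosed.Build F (val_ring_pred) val_ring_subring_closed.

Record val_ring := ValRing { vr_val : F; _ : vr_val \in val_ring_pred }.
HB.instance Definition _ := [isSub for vr_val].
HB.instance Definition _ := [Choice of val_ring by <:].
HB.instance Definition _ :=
  GRing.SubChoice_isSubComNzRing.Build F val_ring_pred val_ring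
    val_ring_subring_closed.

Definition val_ideal : {pred val_ring} :=
  fun a => (val a == 0) || (0 < v (val a)).

Lemma val_ideal_closed : idealr_closed val_ideal.
Proof.
split; rewrite /val_ideal ?unfold_in.
- by rewrite raddf0 eqxx.
- by rewrite rmorph1 oner_eq0 valuation1 ltxx.
move=> a u w; rewrite !unfold_in rmorphD rmorphM.
rewrite /=; have : (vr_val a == 0) || (0 <= v (vr_val a)) := valP a.
move: {a u w} (vr_val a) (vr_val u) (vr_val w) => a u w.
have mulP : (a == 0) || (0 <= v a) -> (u == 0) || (0 < v u) ->
    (a * u == 0) || (0 < v (a * u)).
  have [->|a0] := eqVneq a 0; first by rewrite mul0r eqxx.
  have [->|u0 /= va vu] := eqVneq u 0; first by rewrite mulr0 eqxx.
  rewrite mulrC valuationM//; apply/orP; right; apply: (lt_le_trans vu).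
  by have := ozmod_leD2l (v u) _ _ va; rewrite addr0.
move=> va vu vw; move: (mulP va vu) vw => {va vu mulP}.
move: (a * u) => {a u} u.
have [->|u0 /= vu] := eqVneq u 0; first by rewrite add0r.
have [->|w0 /= vw] := eqVneq w 0; first by rewrite addr0 vu orbT.
have [//|uw0 /=] := eqVneq (u + w) 0.
apply: lt_le_trans (valuationD v u0 w0 uw0).
by rewrite /Order.min; case: ifP.
Qed.

HB.instance Definition _ := isIdealr.Build val_ring val_ideal val_ideal_closed.

Definition max_ideal := Idealr.clone val_ring val_ideal _.

Definition residue_field : Type := {ideal_quot max_ideal}.

HB.instance Definition _ := GRing.ComNzRing.copy residue_field
  {ideal_quot max_ideal}.

Definition residue_proj (a : val_ring) : residue_field :=
  \pi_{ideal_quot max_ideal} a.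

Lemma residue_proj_eq0 a : (residue_proj a == 0) = (a \in val_ideal).
Proof. by rewrite /residue_proj piE Quotient.equivE subr0. Qed.

Lemma residue_projM a b : residue_proj (a * b) = residue_proj a * residue_proj b.
Proof. by rewrite /residue_proj piE. Qed.

Lemma residue_proj1 : residue_proj 1 = 1.
Proof. by rewrite /residue_proj piE. Qed.

Lemma residue_proj_repr (q : residue_field) :
  residue_proj (repr (q : {ideal_quot max_ideal})) = q.
Proof. exact: reprK. Qed.

Definition residue_inv (q : residue_field) : residue_field :=
  if q == 0 then 0
  else residue_proj (insubd 0 (val (repr (q : {ideal_quot max_ideal})))^-1).

Lemma residue_mulVf q : q != 0 -> residue_inv q * q = 1.
Proof.
move=> q0; rewrite /residue_inv (negbTE q0); move: q0.
rewrite -{1 3}[q]residue_proj_repr; set a := repr _.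
rewrite residue_proj_eq0 unfold_in negb_or => /andP[a0 va].
have va0 : v (val a) = 0.
  have := valP a; rewrite unfold_in (negbTE a0) /= le_eqVlt (negbTE va) orbF.
  by move=> /eqP.
rewrite -residue_projM -residue_proj1; congr residue_proj; apply: val_inj.
rewrite /= insubdK ?mulVf//.
by apply/orP; right; rewrite /= valuationV// va0 oppr0.
Qed.

Lemma residue_inv0 : residue_inv 0 = 0.
Proof. by rewrite /residue_inv eqxx. Qed.

HB.instance Definition _ :=
  GRing.ComNzRing_isField.Build residue_field residue_mulVf residue_inv0.

(* The image of a in the residue field; 0 if a is not in the valuation ring. *)
Definition residue (a : F) : residue_field :=
  if insub a is Some b then residue_proj b else 0.

Definition val_sign (a : F) : int :=
  if 0 < v a then 1 else if v a < 0 then - 1 else 0.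

End Valuation.

(* The prescription defining S_rho. The last clause is needed because RP(F_2)
   is generated by C_F and not by [1] = 0; it only concerns |F| = 2. *)
Definition is_specialization (F : fieldType) (G : orderedZmodType)
    (v : valuation F G) (S : RP F -> RPhat (residue_field v)) : Prop :=
  [/\ forall a, a != 0 -> v a = 0 ->
        S (rp a) = RPhat_proj (residue_field v) (rp (residue v a)),
      forall a, a != 0 -> v a != 0 ->
        S (rp a) = RPhat_proj (residue_field v) (RC (residue_field v))
                     *~ val_sign v a
    & has_card F 2 ->
        S (RC F) = RPhat_proj (residue_field v) (RC (residue_field v))].

(* Main.v *)
Require Import Defs.
From HB Require Import structures.
From mathcomp Require Import all_boot all_order all_algebra finmap.
From mathcomp Require Import boolp classical_sets functions cardinality.
From mathcomp Require Import monalg.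
From mathcomp Require Import ring.

Set Implicit Arguments.
Unset Strict Implicit.
Unset Printing Implicit Defensive.

Import Order.TTheory GRing.Theory Num.Theory.
Local Open Scope ring_scope.

(** The map [S] is forced on generators, so everything rests on one point: the
    symbol [T] with [T a = [residue a]] on units and [T a = +- C_k] elsewhere,
    where [F^*] acts through [rho], satisfies the five-term relation in
    [RPhat k].  The remaining claims are formal: [rho] is surjective because
    [R_k] is additively generated by the classes [<u>] of residues of units,
    so the image of [S] is an [R_k]-submodule, and it contains the generators.

    In [RPhat k] the relations [psi1 = psi2 = 0] read
    [[1/x] = - <-1>[x]] and [<x>[x] = <-1>[x]].  They give the five-term
    expression [E(x, y)] two symmetries: for any symbol with
    [T(1/x) = - <-1> T(x)], the inversion [x |-> 1/x], applied to both
    arguments, maps [E] to [- <-1> E], and so does the reflection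
    [x |-> 1 - x] up to the difference of the values of [T(x) + <-1> T(1 - x)]
    at [x] and at [y] ([five_term_inv], [five_term_reflect]).

    Applied to the symbols of [k] itself, where [E = 0], this shows that
    [C = [x] + <-1>[1 - x]] does not depend on [x].  Comparing its values on
    the orbit of [x] under reflection and inversion then yields [3 C = 0] and
    [<x> C = C] ([const_mulr3], [sqchar_const]).  If [k] has two or three
    elements, the same facts about [C_k] are read off from the presentation.

    Applied to [T], with the help of [T(x) + <-1> T(1 - x) = C]
    ([specialized_const]), it reduces the five-term relation to few cases.  A
    point of the projective line over [F] specializes to [0], [1], infinity or
    a generic point of the projective line over [k], and the two symmetries
    permute the three special points.  Hence either [x] may be taken to
    specialize to [0] ([five_term_zero]), or [x] is generic and then [y] either
    specializes to [0] ([five_term_generic_zero]) or is generic too, in which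
    case the relation is the one of [k] ([five_term_generic]).

    A ring homomorphism [rho] may send [<a>] to minus a square class when [a]
    is not a unit, so [<a> C = C] can fail for such [a]; the argument only uses
    that the terms carrying the factor [rho <a>] cancel against each other. *)

(** * Linear maps out of free modules and quotients *)

Lemma malg_lift (R : nzRingType) (K : choiceType) (M : lmodType R) (g : K -> M) :
  exists f : {linear {malg R[K]} -> M}, forall k, f << k >> = g k.
Proof.
pose f (a : {malg R[K]}) : M := \sum_(k <- msupp a) a@_k *: g k.
have f_wide (a : {malg R[K]}) (d : {fset K}) :
    (msupp a `<=` d)%fset -> f a = \sum_(k <- d) a@_k *: g k.
  move=> ad; rewrite /f (big_fset_incl _ ad) // => k _ /mcoeff_outdom ->.
  by rewrite scale0r.
have f_lin : linear f.
  move=> r a b; pose d := (msupp (r *: a + b) `|` (msupp a `|` msupp b))%fset.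
  rewrite (f_wide _ d) ?fsubsetUl// (f_wide a d); last first.
    by rewrite fsubsetU ?fsubsetUl ?orbT.
  rewrite (f_wide b d); last by rewrite fsubsetU ?fsubsetUr ?orbT.
  rewrite scaler_sumr -big_split /=; apply: eq_bigr => k _.
  by rewrite mcoeffD mcoeffZ scalerDl scalerA.
pose fL : {linear {malg R[K]} -> M} :=
  HB.pack f (GRing.isLinear.Build R {malg R[K]} M *:%R f f_lin).
exists fL => k; rewrite /fL /= (f_wide _ _ msuppU_le).
by rewrite big_seq_fset1 mcoeffUU scale1r.
Qed.

Lemma quotmod_lift (R : nzRingType) (M N : lmodType R) (A : set M)
    (f : {linear M -> N}) :
  (forall x, A x -> f x = 0) ->
  exists g : {linear quotmod A -> N}, forall x, g (qproj A x) = f x.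
Proof.
move=> fA; pose g (q : quotmod A) : N := f (repr (q : {ideal_quot span_closed A})).
have f_span x : Defs.span A x -> f x = 0.
  by elim=> [|r a b /fA fa0 _ fb0]; rewrite ?raddf0// linearP fa0 fb0 scaler0 addr0.
have gE x : g (qproj A x) = f x.
  apply/eqP; rewrite -subr_eq0 -raddfB; apply/eqP/f_span.
  by apply/qprojP; rewrite qproj_repr.
have g_lin : linear g.
  move=> r q q'; rewrite -(qproj_repr q) -(qproj_repr q') -linearP /=.
  by rewrite !gE linearP.
pose gL : {linear quotmod A -> N} :=
  HB.pack g (GRing.isLinear.Build R (quotmod A) N *:%R g g_lin).
by exists gL.
Qed.

(** The linear combinations in which the defining relations and the elements
    [psi1], [psi2] and [RC_at] are written. *)
Lemma linear_five_sum (R : nzRingType) (U V : lmodType R) (f : {linear U -> V})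
    a b p q e (r s t : R) :
  f (a - b + r *: p - s *: q + t *: e) =
  f a - f b + r *: f p - s *: f q + t *: f e.
Proof. by rewrite !raddfD !raddfN /= !linearZ. Qed.

Lemma linear_addZ_muln (R : nzRingType) (U V : lmodType R) (f : {linear U -> V})
    a b (r : R) n :
  f ((a + r *: b) *+ n) = (f a + r *: f b) *+ n.
Proof. by rewrite raddfMn raddfD /= linearZ. Qed.

Lemma linear_addZ (R : nzRingType) (U V : lmodType R) (f : {linear U -> V})
    a b (r : R) :
  f (a + r *: b) = f a + r *: f b.
Proof. by rewrite raddfD /= linearZ. Qed.

Lemma linear_scaleDZ (R : nzRingType) (U V : lmodType R)
    (f : {linear U -> V}) a b (r t : R) :
  f (t *: (r *: a + b)) = t *: (r *: f a + f b).
Proof. by rewrite linearZ /= raddfD /= linearZ. Qed.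

Lemma linear_addZ_ker (R : nzRingType) (U V : lmodType R)
    (f : {linear U -> V}) a b c (r t : R) :
  f c = 0 -> f (a + r *: b + t *: c) = f a + r *: f b.
Proof. by move=> fc; rewrite linear_addZ fc scaler0 addr0 linear_addZ. Qed.

Lemma qproj_eq0 (R : nzRingType) (M : lmodType R) (A : set M) x :
  A x -> qproj A x = 0.
Proof.
move=> Ax; apply/eqP; rewrite -(raddf0 (qproj A)); apply/qprojP.
by rewrite subr0; apply: Defs.sub_span.
Qed.

(** * Square classes and their group ring *)

Section SquareClass.
Variable F : fieldType.

Lemma fval_to_unit (x : F) : x != 0 -> fval (to_unit x) = x.
Proof. by move=> x0; rewrite /to_unit; apply: insubdK. Qed.

Lemma sqcM (x y : F) : x != 0 -> y != 0 -> sqc (x * y) = sqc x * sqc y.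
Proof.
move=> x0 y0; rewrite /sqc [RHS]gr_mulUU mulr1; congr << 1 *g _ >>.
rewrite [RHS]sqclass_piM; congr to_sqclass; apply: val_inj.
by rewrite /= !fval_to_unit ?mulf_neq0.
Qed.

Lemma sqc_sq (x : F) : x != 0 -> sqc x * sqc x = 1.
Proof.
move=> x0; rewrite [LHS]gr_mulUU mulr1; congr << 1 *g _ >>.
rewrite [LHS]sqclass_piM; apply/eqP/sqclassP.
by exists (to_unit x); rewrite mul1g expg2.
Qed.

(** Subtraction instead of addition makes multiples by negative integers come
    for free. *)
Lemma RF_ind (P : RF F -> Prop) :
  P 0 -> (forall a b, P a -> P b -> P (a - b)) ->
  (forall x, x != 0 -> P (sqc x)) -> forall a, P a.
Proof.
move=> P0 PB Pc.
have PN a : P a -> P (- a) by rewrite -sub0r; apply: PB.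
have PD a b : P a -> P b -> P (a + b).
  by move=> Pa Pb; rewrite -[b]opprK; apply/PB/PN.
apply: gr_ind => // z g.
have -> : << z *g g >> = sqc (fval (repr g)) *~ z :> RF F.
  have -> : sqc (fval (repr g)) = gr_in g.
    rewrite /sqc; congr gr_in; rewrite -[RHS]to_sqclassK; congr to_sqclass.
    by apply: val_inj; rewrite /= fval_to_unit ?fval_neq0.
  rewrite /gr_in; case: z => n.
    by rewrite -pmulrn -monalgUMn natz.
  by rewrite NegzE mulrNz -pmulrn -monalgUMn natz monalgUN.
move: (Pc _ (fval_neq0 (repr g))) => Pg.
have Pn n : P (sqc (fval (repr g)) *+ n).
  by elim: n => [|n IH]; rewrite ?mulr0n// mulrS; apply: PD.
by case: z => n; rewrite ?NegzE ?mulrNz; [|apply: PN]; rewrite -pmulrn.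
Qed.

End SquareClass.

(** * The five-term expression and its symmetries *)

Lemma subr1_neq0 (F : fieldType) (x : F) : x != 1 -> 1 - x != 0.
Proof. by rewrite subr_eq0 eq_sym. Qed.

Lemma subr1_neq1 (F : fieldType) (x : F) : x != 0 -> 1 - x != 1.
Proof. by rewrite -{1}(subKr 1 x) subr_eq0 eq_sym. Qed.

Lemma invr_neq1 (F : fieldType) (x : F) : x != 1 -> x^-1 != 1.
Proof. by rewrite invr_eq1. Qed.

(** [r] is the map [x |-> <x>] or its composite with [rho], whose values need
    not be square classes. *)
Section FiveTerm.
Variables (F : fieldType) (R : nzRingType) (Q : lmodType R).
Variables (r : F -> R) (T : F -> Q).
Hypothesis rM : forall x y : F, x != 0 -> y != 0 -> r (x * y) = r x * r y.
Hypothesis rr : forall x : F, x != 0 -> r x * r x = 1.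
Hypothesis TV : forall x : F, x != 0 -> T x^-1 = - (r (-1) *: T x).
Local Notation s := (r (-1)).

(** With [t = y / x] and [w = (1 - x) / (1 - y)] the arguments are [t], [t w]
    and [w], which reflection and inversion permute up to inverses; so the
    symmetries act on this part by a sign and [s], without correction terms.
    The coefficient of [T (t w)] is the class of [x (1 - x)], which differs from
    [1/x - 1] by a square; [five_termE] compares with the usual form. *)
Definition five_tail x y :=
  r x *: T (y / x) - (r x * r (1 - x)) *: T (y / x * ((1 - x) / (1 - y)))
  + r (1 - x) *: T ((1 - x) / (1 - y)).

Definition five_term x y := T x - T y + five_tail x y.

Let sM : s * s = 1.
Proof. by rewrite rr ?oppr_eq0 ?oner_eq0. Qed.

Lemma sqchar_comm x y : x != 0 -> y != 0 -> r x * r y = r y * r x.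
Proof. by move=> x0 y0; rewrite -!rM// mulrC. Qed.

Lemma sqchar1 : r 1 = 1.
Proof. by rewrite -{1}(mulr1 1) rM ?oner_eq0// rr ?oner_eq0. Qed.

Lemma sqcharV x : x != 0 -> r x^-1 = r x.
Proof.
move=> x0; have xV0 : x^-1 != 0 by rewrite invr_eq0.
by rewrite -[LHS]mul1r -(rr x0) -mulrA -rM// divff// sqchar1 mulr1.
Qed.

Let s_comm x : x != 0 -> s * r x = r x * s.
Proof. by move=> x0; rewrite sqchar_comm// oppr_eq0 oner_eq0. Qed.

Lemma sqchar_one_subV x : x != 0 -> x != 1 ->
  r (1 - x^-1) = s * (r x * r (1 - x)).
Proof.
move=> x0 x1; have u0 := subr1_neq0 x1.
rewrite -(sqcharV x0) -!rM ?mulf_neq0 ?invr_eq0 ?oppr_eq0 ?oner_eq0//.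
by congr r; field.
Qed.

Let s_conj t (m : Q) : s * t = t * s -> s *: (t *: - (s *: m)) = - (t *: m).
Proof. by move=> st; rewrite !scalerN !scalerA -mulrA -st mulrA sM mul1r. Qed.

Lemma five_termE x y : x != 0 -> x != 1 -> y != 0 -> y != 1 ->
  T x - T y + r x *: T (y / x)
  - r (x^-1 - 1) *: T ((1 - x^-1) / (1 - y^-1))
  + r (1 - x) *: T ((1 - x) / (1 - y)) = five_term x y.
Proof.
move=> x0 x1 y0 y1; rewrite /five_term /five_tail !addrA.
have [u0 w0] := (subr1_neq0 x1, subr1_neq0 y1).
have -> : (1 - x^-1) / (1 - y^-1) = y / x * ((1 - x) / (1 - y)).
  have w'0 : y - 1 != 0 by rewrite subr_eq0.
  by field; rewrite ?x0 ?y0 ?w0 ?w'0.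
suff -> : r (x^-1 - 1) = r x * r (1 - x) by [].
have -> : x^-1 - 1 = x^-1 * x^-1 * (x * (1 - x)) by field.
by rewrite 3?rM ?mulf_neq0 ?invr_neq0// rr ?mul1r// invr_neq0.
Qed.

(** Reflection exchanges [t] with [1 / w] and inverts [t w]; the factor
    [- s] from inverting each argument cancels the outer [s]. *)
Lemma five_tail_reflect x y : x != 0 -> x != 1 -> y != 0 -> y != 1 ->
  s *: five_tail (1 - x) (1 - y) = - five_tail x y.
Proof.
move=> x0 x1 y0 y1.
have u0 := subr1_neq0 x1.
have w0 := subr1_neq0 y1.
rewrite /five_tail !subKr -(invf_div (1 - x)) -(invf_div y) -invfM.
rewrite [(1 - x) / (1 - y) * _]mulrC !TV ?mulf_neq0 ?invr_eq0//.
have s_pq : s * (r (1 - x) * r x) = r (1 - x) * r x * s.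
  by rewrite mulrA s_comm// -mulrA s_comm// mulrA.
rewrite scalerDr scalerBr !s_conj ?s_comm//.
rewrite (sqchar_comm u0 x0) !opprD !opprK addrC.
by rewrite [X in _ + X = _]addrC addrA.
Qed.

(** Inversion maps [t] to [1 / t] and exchanges [w] with [t w], while the
    coefficient [r (1 - 1/x)] is [s r(x) r(1 - x)]. *)
Lemma five_tail_inv x y : x != 0 -> x != 1 -> y != 0 -> y != 1 ->
  s *: five_tail x^-1 y^-1 = - five_tail x y.
Proof.
move=> x0 x1 y0 y1.
have u0 := subr1_neq0 x1.
have w0 := subr1_neq0 y1.
have wt : (1 - x^-1) / (1 - y^-1) = y / x * ((1 - x) / (1 - y)).
  have w'0 : y - 1 != 0 by rewrite subr_eq0.
  by field; rewrite ?x0 ?y0 ?w0 ?w'0.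
rewrite /five_tail sqcharV// sqchar_one_subV// wt -invfM.
rewrite mulKf ?mulf_neq0 ?invr_eq0// TV ?mulf_neq0 ?invr_eq0//.
have s_pq : s * (r x * r (1 - x)) = r x * r (1 - x) * s.
  by rewrite mulrA s_comm// -mulrA s_comm// mulrA.
have s_s t (m : Q) : s *: ((s * t) *: m) = t *: m.
  by rewrite scalerA mulrA sM mul1r.
have -> : r x * (s * (r x * r (1 - x))) = s * r (1 - x).
  by rewrite mulrA -s_comm// -mulrA (mulrA (r x)) rr// mul1r.
rewrite scalerDr scalerBr s_conj ?(s_comm x0)// !s_s.
by rewrite !opprD !opprK addrAC.
Qed.

Lemma five_term_reflect x y : x != 0 -> x != 1 -> y != 0 -> y != 1 ->
  five_term x y + s *: five_term (1 - x) (1 - y) =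
  (T x + s *: T (1 - x)) - (T y + s *: T (1 - y)).
Proof.
move=> x0 x1 y0 y1; rewrite /five_term scalerDr five_tail_reflect//.
by rewrite addrACA subrr addr0 scalerBr opprD addrACA.
Qed.

Lemma five_term_inv x y : x != 0 -> x != 1 -> y != 0 -> y != 1 ->
  five_term x y + s *: five_term x^-1 y^-1 = 0.
Proof.
move=> x0 x1 y0 y1; rewrite /five_term scalerDr five_tail_inv//.
rewrite addrACA subrr addr0 scalerBr !TV// !scalerN !scalerA sM !scale1r.
by rewrite opprK addrACA subrr addNr addr0.
Qed.

Hypothesis five0 : forall x y : F, x != 0 -> x != 1 -> y != 0 -> y != 1 ->
  five_term x y = 0.
Hypothesis rT : forall x : F, x != 0 -> r x *: T x = s *: T x.

Let C x := T x + s *: T (1 - x).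

Let ss (m : Q) : s *: (s *: m) = m.
Proof. by rewrite scalerA sM scale1r. Qed.

Let s_swap x (m : Q) : x != 0 -> s *: (r x *: m) = r x *: (s *: m).
Proof. by move=> x0; rewrite !scalerA s_comm. Qed.

(** The difference of the two sides is a combination of two five-term
    relations, by reflection. *)
Lemma const_eq x y : x != 0 -> x != 1 -> y != 0 -> y != 1 -> C x = C y.
Proof.
move=> x0 x1 y0 y1; have := five_term_reflect x0 x1 y0 y1.
rewrite !five0 ?subr1_neq0 ?subr1_neq1// scaler0 addr0.
by move/esym/eqP; rewrite subr_eq0 => /eqP.
Qed.

Lemma const_sN1 x : x != 0 -> x != 1 -> s *: C x = C x.
Proof.
move=> x0 x1; rewrite [RHS](const_eq x0 x1 (subr1_neq0 x1) (subr1_neq1 x0)).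
by rewrite /C subKr scalerDr ss addrC.
Qed.

(** The values of [C] at [1 - x], [1 / x] and [1 / (1 - x)] express it through
    the three elements [T x], [T (1 - x)] and [T (1 - 1/x)] only, in three
    different ways. *)
Section Orbit.
Variable x : F.
Hypotheses (x0 : x != 0) (x1 : x != 1).

Let C_ab : C x = s *: T x + T (1 - x).
Proof. by rewrite -const_sN1// scalerDr ss. Qed.

Let C_ac : C x = T (1 - x^-1) - T x.
Proof.
rewrite -const_sN1// (const_eq x0 x1 (invr_neq0 x0) (invr_neq1 x1)).
by rewrite /C TV// scalerDr scalerN !ss addrC.
Qed.

Let C_bc : C x = - (T (1 - x) + s *: T (1 - x^-1)).
Proof.
have [u0 u1] := (subr1_neq0 x1, subr1_neq1 x0).
rewrite -const_sN1// (const_eq x0 x1 (invr_neq0 u0) (invr_neq1 u1)).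
have -> : C (1 - x)^-1 = - (s *: T (1 - x)) - T (1 - x^-1).
  have z0 := subr1_neq0 (invr_neq1 x1).
  rewrite /C TV//; have -> : 1 - (1 - x)^-1 = (1 - x^-1)^-1.
    by field; rewrite x0 u0 subr_eq0 x1.
  by rewrite TV// scalerN ss.
by rewrite scalerBr scalerN ss opprD.
Qed.

(** The three expressions add up to zero. *)
Lemma const_mulr3 : C x *+ 3 = 0.
Proof.
have C_sac : C x = s *: T (1 - x^-1) - s *: T x.
  by rewrite -const_sN1// C_ac scalerBr.
rewrite mulrSr mulr2n {1}C_ab {1}C_bc C_sac.
by rewrite opprD !addrA addrK subrK subrr.
Qed.

(** Each of the three elements is multiplied by [s] under its own square class,
    and [r (1 - 1/x) = s r(x) r(1 - x)]; so [r x] and [r (1 - x)] agree on the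
    third element, which cancels from the sum. *)
Lemma sqchar_const_add : r x *: C x + r (1 - x) *: C x = - C x.
Proof.
have [u0 z0] := (subr1_neq0 x1, subr1_neq0 (invr_neq1 x1)).
have c_fix : r (1 - x) *: T (1 - x^-1) = r x *: T (1 - x^-1).
  have := rT z0; rewrite sqchar_one_subV// -scalerA => /(congr1 ( *:%R s)).
  rewrite !ss -scalerA => {2}<-.
  by rewrite !scalerA rr// mul1r.
have sC : r x *: C x = s *: (r x *: C x).
  by rewrite s_swap// const_sN1.
have -> : r x *: C x = s *: (r x *: T (1 - x^-1)) - T x.
  by rewrite sC C_ac !scalerBr rT// ss.
have -> : r (1 - x) *: C x = - (s *: T (1 - x) + s *: (r x *: T (1 - x^-1))).
  by rewrite C_bc scalerN scalerDr rT// -s_swap// c_fix.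
by rewrite addrC opprD addrA subrK -opprD addrC.
Qed.

End Orbit.

(** Comparing [sqchar_const_add] at [x] and at [1 / x] gives
    [r (1 - x) C = r x r (1 - x) C], and [r (1 - x)] is invertible. *)
Lemma sqchar_const x y : x != 0 -> y != 0 -> y != 1 -> r x *: C y = C y.
Proof.
have [->|x1] := eqVneq x 1; first by rewrite sqchar1 scale1r.
move=> x0 y0 y1; rewrite -(const_eq x0 x1 y0 y1).
have [u0 C_V] := (subr1_neq0 x1, const_eq x0 x1 (invr_neq0 x0) (invr_neq1 x1)).
have := sqchar_const_add (invr_neq0 x0) (invr_neq1 x1).
rewrite -C_V -(sqchar_const_add x0 x1) sqcharV// sqchar_one_subV// => /addrI.
have -> : (s * (r x * r (1 - x))) *: C x = r (1 - x) *: (r x *: C x).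
  rewrite sqchar_comm// mulrA s_comm// -mulrA s_comm// mulrA -scalerA.
  by rewrite const_sN1// -scalerA.
move/(congr1 ( *:%R (r (1 - x)))).
by rewrite !(scalerA (r (1 - x))) rr// !scale1r.
Qed.

End FiveTerm.

(** * The universal property of the refined pre-Bloch group *)

Section Presentation.
Variable F : fieldType.

Lemma rp1 : rp (1 : F) = 0.
Proof. exact/qproj_eq0/RP_rel_one. Qed.

Lemma RC_card2 : has_card F 2 -> RC F = qproj (@RP_rel F) (RP_genC F).
Proof. by rewrite /RC => ->. Qed.

Lemma RP_ind (P : RP F -> Prop) :
  P 0 -> (forall m n, P m -> P n -> P (m + n)) ->
  (forall r x, x != 0 -> P (r *: rp x)) ->
  (has_card F 2 -> forall r, P (r *: RC F)) ->
  forall m, P m.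
Proof.
move=> P0 PD Px PC m; rewrite -(qproj_repr m).
move: (repr _) => a; rewrite [a]monalgE raddf_sum.
elim/big_ind: _ => //= k _.
have -> : << a@_k *g k >> = a@_k *: << 1 *g k >> :> RP_free F.
  by apply/malgP => j; rewrite mcoeffZ !mcoeffU mulrnAr mulr1.
rewrite linearZ /=; case: k => [u|].
  have -> : qproj (@RP_rel F) << Some u >> = rp (fval u).
    congr (qproj _ << Some _ >>); apply: val_inj.
    by rewrite /= fval_to_unit ?fval_neq0.
  exact/Px/fval_neq0.
have [F2|F2] := boolP (has_card F 2); first by rewrite -RC_card2//; apply: PC.
suff -> : qproj (@RP_rel F) << None >> = 0 by rewrite scaler0.
exact/qproj_eq0/RP_rel_noC.
Qed.

Lemma RP_lift (M : lmodType (RF F)) (g : F -> M) (c : M) :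
  g 1 = 0 ->
  (forall x y : F, x != 0 -> x != 1 -> y != 0 -> y != 1 ->
     five_term (@sqc F) g x y = 0) ->
  (g (-1) + sqc (-1) *: g (-1)) *+ 2 = 0 ->
  c *+ 3 = 0 ->
  exists S : {linear RP F -> M},
    (forall x, x != 0 -> S (rp x) = g x) /\ (has_card F 2 -> S (RC F) = c).
Proof.
move=> g1 g5 g3 c3.
pose h (k : option (funit F)) : M :=
  if k is Some u then g (fval u) else if has_card F 2 then c else 0.
have [f fh] : exists f : {linear RP_free F -> M}, forall k, f << k >> = h k.
  exact: malg_lift.
have fx (x : F) : x != 0 -> f (RP_gen x) = g x.
  by move=> x0; rewrite /RP_gen fh /= fval_to_unit.
have [|S SE] := @quotmod_lift _ _ _ (@RP_rel F) f.
  move=> _ [|x y _ x0 x1 y0 y1|F3|F2|/negbTE F2].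
  - by rewrite fx ?oner_eq0.
  - have [u0 w0] := (subr1_neq0 x1, subr1_neq0 y1).
    have [u'0 w'0] := (subr1_neq0 (invr_neq1 x1), subr1_neq0 (invr_neq1 y1)).
    rewrite linear_five_sum -[RHS](g5 x y)// -(five_termE g (@sqcM F) (@sqc_sq F))//.
    by congr (_ - _ + _ *: _ - _ *: _ + _ *: _); apply: fx;
       rewrite ?mulf_neq0 ?invr_eq0.
  - rewrite linear_addZ_muln -[RHS]g3.
    by congr ((_ + _ *: _) *+ 2); apply: fx; rewrite oppr_eq0 oner_eq0.
  - by rewrite linearMn fh /= F2 c3.
  - by rewrite fh /= F2.
exists S; split=> [x x0|F2]; first by rewrite /rp SE fx.
by rewrite RC_card2// SE fh /= F2.
Qed.

Lemma RP_linear_ext (M : lmodType (RF F)) (f g : {linear RP F -> M}) :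
  (forall x, x != 0 -> f (rp x) = g (rp x)) ->
  (has_card F 2 -> f (RC F) = g (RC F)) ->
  f =1 g.
Proof.
move=> fgx fgC; apply: RP_ind => [|m n fgm fgn|r x x0|F2 r].
- exact: etrans (raddf0 f) (esym (raddf0 g)).
- apply: etrans (raddfD f m n) (etrans _ (esym (raddfD g m n))).
  exact: congr2 fgm fgn.
- apply: etrans (linearZ_LR f r _) (etrans _ (esym (linearZ_LR g r _))).
  exact: congr1 (fgx x x0).
- apply: etrans (linearZ_LR f r _) (etrans _ (esym (linearZ_LR g r _))).
  exact: congr1 (fgC F2).
Qed.

End Presentation.

(** * Fields with at most three elements *)

Section Cardinality.
Variable F : fieldType.
Implicit Type s : seq F.

Lemma uniq_card s : uniq s -> (`I_(size s) #<= [set: F])%card.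
Proof.
move=> s_uniq.
have /card_eq_fsetP E : #|` seq_fset tt s| = size s by rewrite size_seq_fset undup_id.
by rewrite -(card_le_eql E) subset_card_le.
Qed.

Lemma has_card_size n s : has_card F n -> uniq s -> (size s <= n)%N.
Proof.
by move=> Fn /uniq_card; rewrite (card_le_eqr Fn) card_le_II.
Qed.

Lemma uniq_has_card s : uniq s -> (forall x, x \in s) -> has_card F (size s).
Proof.
move=> s_uniq s_all; rewrite /has_card.
have /card_eq_fsetP E : #|` seq_fset tt s| = size s by rewrite size_seq_fset undup_id.
suff -> : [set: F]%classic = [set` seq_fset tt s]%classic by [].
by apply/seteqP; split=> x // _; rewrite /= (seq_fsetE tt).
Qed.

Lemma card2_eq1 : has_card F 2 -> forall x : F, x != 0 -> x = 1.
Proof.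
move=> F2 x x0; apply: contrapT => /eqP x1.
have /= := @has_card_size _ [:: 0; 1; x] F2.
rewrite !inE !(eq_sym 0) oner_eq0 (negbTE x0) eq_sym (negbTE x1).
by move=> /(_ isT).
Qed.

Lemma card3_unique : has_card F 3 ->
  forall x y : F, x != 0 -> x != 1 -> y != 0 -> y != 1 -> y = x.
Proof.
move=> F3 x y x0 x1 y0 y1; apply: contrapT => /eqP yx.
have /= := @has_card_size _ [:: 0; 1; x; y] F3.
rewrite !inE !(eq_sym 0) oner_eq0 (negbTE x0) (negbTE y0).
rewrite !(eq_sym 1) (negbTE x1) (negbTE y1) eq_sym (negbTE yx).
by move=> /(_ isT).
Qed.

Lemma not_card2 : ~~ has_card F 2 -> exists x : F, x != 0 /\ x != 1.
Proof.
move=> F2; apply: contrapT => noex; case/negP: F2.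
apply: (@uniq_has_card [:: 0; 1]) => [|x]; first by rewrite /= inE eq_sym oner_eq0.
rewrite !inE; apply: contrapT => /negP; rewrite negb_or => /andP[x0 x1].
by apply: noex; exists x.
Qed.

End Cardinality.

(** * Relations in the reduced pre-Bloch group *)

(** All that the specialization argument needs to know about [[x]] and [C_k] in
    [RPhat k], uniformly in the cardinality of [k]. *)
Record hat_symbol (k : fieldType) (R : nzRingType) (M : lmodType R)
    (r : k -> R) (h : k -> M) (C : M) : Prop := HatSymbol {
  hat_rM : forall x y : k, x != 0 -> y != 0 -> r (x * y) = r x * r y;
  hat_rr : forall x : k, x != 0 -> r x * r x = 1;
  hat1 : h 1 = 0;
  hatV : forall x : k, x != 0 -> h x^-1 = - (r (-1) *: h x);
  hat_sq : forall x : k, x != 0 -> r x *: h x = r (-1) *: h x;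
  hat_five : forall x y : k, x != 0 -> x != 1 -> y != 0 -> y != 1 ->
    five_term r h x y = 0;
  hat_const : forall x : k, x != 0 -> x != 1 -> h x + r (-1) *: h (1 - x) = C;
  hat_const3 : C *+ 3 = 0;
  hat_constZ : forall x : k, x != 0 -> r x *: C = C
}.

Section SymbolMap.
Variables (k : fieldType) (R : nzRingType) (M : lmodType R).
Variables (r : k -> R) (h : k -> M).
Local Notation s := (r (-1)).

Hypothesis rM : forall x y : k, x != 0 -> y != 0 -> r (x * y) = r x * r y.
Hypothesis rr : forall x : k, x != 0 -> r x * r x = 1.

Hypothesis h1 : h 1 = 0.
Hypothesis h_psi1 : forall x, x != 0 -> h x + s *: h x^-1 = 0.
Hypothesis h_psi2 : forall x, x != 0 -> x != 1 ->
  r (1 - x) *: (r x *: h x + h x^-1) = 0.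
Hypothesis h_five : (`I_4 #<= [set: k])%card ->
  forall x y, x != 0 -> x != 1 -> y != 0 -> y != 1 ->
    h x - h y + r x *: h (y / x)
    - r (x^-1 - 1) *: h ((1 - x^-1) / (1 - y^-1))
    + r (1 - x) *: h ((1 - x) / (1 - y)) = 0.

Let ss (m : M) : s *: (s *: m) = m.
Proof. by rewrite scalerA rr ?scale1r// oppr_eq0 oner_eq0. Qed.

Lemma symbolV x : x != 0 -> h x^-1 = - (s *: h x).
Proof.
move=> x0; have /(congr1 ( *:%R s)) := h_psi1 x0.
rewrite scalerDr ss scaler0 addrC => /eqP.
by rewrite addr_eq0 => /eqP.
Qed.

Lemma sqc_symbol x : x != 0 -> r x *: h x = s *: h x.
Proof.
move=> x0; have [->|x1] := eqVneq x 1; first by rewrite h1 !scaler0.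
have /(congr1 ( *:%R (r (1 - x)))) := h_psi2 x0 x1.
rewrite scalerA rr ?subr1_neq0// scale1r scaler0 symbolV// => /eqP.
by rewrite subr_eq0 => /eqP.
Qed.

(** For [x = y] the relation is trivial, and for [x <> y] the field has the four
    distinct elements [0], [1], [x], [y]. *)
Lemma symbol_five (x y : k) : x != 0 -> x != 1 -> y != 0 -> y != 1 ->
  five_term r h x y = 0.
Proof.
move=> x0 x1 y0 y1; have [->|xy] := eqVneq y x.
  have u0 := subr1_neq0 x1.
  by rewrite /five_term /five_tail !divff// mulr1 h1 !scaler0 !subrr !addr0.
have k4 : (`I_4 #<= [set: k])%card.
  apply: (@uniq_card _ [:: 0; 1; x; y]); rewrite /= !inE !negb_or.
  by rewrite !(eq_sym 0) oner_eq0 x0 y0 !(eq_sym 1) x1 y1 (eq_sym x) xy.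
by rewrite -(five_termE h rM rr)// h_five.
Qed.

(** The alternatives correspond to two, three and more elements.  With three
    elements the only nontrivial argument is [x = -1], for which
    [1 - x = 1/x = x], and the constant is [psi1 (-1) = 0]. *)
Lemma hat_symbol_intro C :
  [\/ (forall x : k, x != 0 -> x = 1) /\ C *+ 3 = 0,
      (forall x : k, x != 0 -> x != 1 -> x^-1 = x /\ 1 - x = x) /\ C = 0
    | exists x : k, [/\ x != 0, x != 1 & C = h x + s *: h (1 - x)]] ->
  hat_symbol r h C.
Proof.
move=> H; split=> //; [exact: symbolV|exact: sqc_symbol|exact: symbol_five|..].
- case: H => [[k2 _]|[k3 ->]|[y [y0 y1 ->]]] x x0 x1.
  + by rewrite (k2 _ x0) eqxx in x1.
  + by have [xV x'] := k3 x x0 x1; rewrite x' -{2}xV h_psi1.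
  + exact: (const_eq rM rr symbolV symbol_five).
- case: H => [[_ ->]|[_ ->]|[y [y0 y1 ->]]] //; first by rewrite mul0rn.
  exact: (const_mulr3 rM rr symbolV symbol_five).
- case: H => [[k2 _]|[k3 ->]|[y [y0 y1 ->]]] x x0.
  + by rewrite (k2 _ x0) (sqchar1 rM rr) scale1r.
  + by rewrite scaler0.
  + exact: (sqchar_const rM rr symbolV symbol_five sqc_symbol).
Qed.

End SymbolMap.

Lemma RPhat_psi1 (k : fieldType) (x : k) : x != 0 -> RPhat_proj k (psi1 x) = 0.
Proof.
move=> x0; apply: qproj_eq0; exists (psi1 x); last first.
  by exists 0; [apply: span0|rewrite addr0].
by apply: Defs.sub_span; exists x.
Qed.

Lemma RPhat_psi2 (k : fieldType) (x : k) : x != 0 -> RPhat_proj k (psi2 x) = 0.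
Proof.
move=> x0; apply: qproj_eq0; exists 0; first exact: span0.
by exists (psi2 x); [apply: Defs.sub_span; exists x|rewrite add0r].
Qed.

Section Hat.
Variable k : fieldType.
Local Notation s := (sqc (-1 : k)).

Definition rphat (x : k) : RPhat k := RPhat_proj k (rp x).
Definition RChat : RPhat k := RPhat_proj k (RC k).

Let rphat1 : rphat 1 = 0.
Proof. by rewrite /rphat rp1 raddf0. Qed.

Let rphat_psi1 (x : k) : x != 0 -> rphat x + s *: rphat x^-1 = 0.
Proof.
move=> x0.
apply: etrans (esym (linear_addZ (RPhat_proj k) (rp x) (rp x^-1) s)) _.
exact: RPhat_psi1.
Qed.

Let rphat_psi2 (x : k) : x != 0 -> x != 1 ->
  sqc (1 - x) *: (sqc x *: rphat x + rphat x^-1) = 0.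
Proof.
move=> x0 x1; have := RPhat_psi2 x0; rewrite /psi2 (negbTE x1).
exact: etrans (esym (linear_scaleDZ (RPhat_proj k) (rp x) (rp x^-1) _ _)).
Qed.

Let rphat_five : (`I_4 #<= [set: k])%card ->
  forall x y : k, x != 0 -> x != 1 -> y != 0 -> y != 1 ->
    rphat x - rphat y + sqc x *: rphat (y / x)
    - sqc (x^-1 - 1) *: rphat ((1 - x^-1) / (1 - y^-1))
    + sqc (1 - x) *: rphat ((1 - x) / (1 - y)) = 0.
Proof.
move=> k4 x y x0 x1 y0 y1.
apply: etrans (esym (linear_five_sum (RPhat_proj k) _ _ _ _ _ _ _ _)) _.
apply: etrans (congr1 (RPhat_proj k) _) (raddf0 _).
apply: etrans (esym (linear_five_sum (qproj (@RP_rel k)) _ _ _ _ _ _ _ _)) _.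
exact: qproj_eq0 (RP_rel_five k4 x0 x1 y0 y1).
Qed.

(** The correction term of [RC_at] is a multiple of [psi1 x]. *)
Lemma RChat_at (x : k) : x != 0 ->
  RPhat_proj k (RC_at x) = rphat x + s *: rphat (1 - x).
Proof. by move=> x0; apply: linear_addZ_ker; apply: RPhat_psi1. Qed.

Theorem RPhat_symbol : hat_symbol (@sqc k) rphat RChat.
Proof.
apply: (hat_symbol_intro (@sqcM k) (@sqc_sq k) rphat1 rphat_psi1 rphat_psi2 rphat_five).
rewrite /RChat /RC; have [k2|k2] := boolP (has_card k 2).
  apply: Or31; split; first exact: card2_eq1.
  apply: etrans (esym (raddfMn _ _ _)) _.
  apply: etrans (congr1 (RPhat_proj k) _) (raddf0 _).
  apply: etrans (esym (raddfMn _ _ _)) _.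
  exact/qproj_eq0/RP_rel_F2.
have [k3|k3] := boolP (has_card k 3).
  apply: Or32; split=> [x x0 x1|]; last first.
    by apply: RPhat_psi1; rewrite oppr_eq0 oner_eq0.
  by split; apply: card3_unique; rewrite ?invr_neq0 ?invr_neq1 ?subr1_neq0 ?subr1_neq1.
apply: Or33; have [x0 x1] := xgetPex 0 (not_card2 k2).
by eexists; split; [exact: x0|exact: x1|exact: RChat_at].
Qed.

End Hat.

(** * Units, residues and specialization of points *)

Section Residue.
Variables (F : fieldType) (G : orderedZmodType) (v : valuation F G).
Local Notation k := (residue_field v).
Local Notation O := (val_ring_pred v).

Lemma ozmod_sign (g : G) : [\/ g = 0, 0 < g | g < 0].
Proof.
have [->|g0] := eqVneq g 0; first exact: Or31.
have /orP[h|h] := ozmod_total 0 g; [apply: Or32|apply: Or33].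
  by rewrite lt_neqAle h eq_sym g0.
by rewrite lt_neqAle h g0.
Qed.

Lemma ozmod_oppr_lt0 (g : G) : 0 < g -> - g < 0.
Proof.
move=> g0; rewrite lt_neqAle; apply/andP; split.
  by apply/eqP => /eqP; rewrite oppr_eq0 => /eqP gz; rewrite gz ltxx in g0.
by have := ozmod_leD2l (- g) _ _ (ltW g0); rewrite addr0 addNr.
Qed.

Lemma ozmod_oppr_gt0 (g : G) : g < 0 -> 0 < - g.
Proof.
move=> g0; rewrite lt_neqAle; apply/andP; split.
  by apply/eqP => /esym/eqP; rewrite oppr_eq0 => /eqP gz; rewrite gz ltxx in g0.
by have := ozmod_leD2l (- g) _ _ (ltW g0); rewrite addr0 addNr.
Qed.

Lemma ozmod_addr_lt0 (g g' : G) : g <= 0 -> g' < 0 -> g + g' < 0.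
Proof.
move=> g0 g'0; rewrite addrC; apply: le_lt_trans g'0.
by have := ozmod_leD2l g' _ _ g0; rewrite addr0.
Qed.

Lemma valuation_div x y : x != 0 -> y != 0 -> v (x / y) = v x - v y.
Proof. by move=> x0 y0; rewrite valuationM ?invr_neq0// valuationV. Qed.

Lemma val_ring_ge0 x : 0 <= v x -> x \in O.
Proof. by rewrite /in_mem /= /val_ring_pred => ->; rewrite orbT. Qed.

Lemma val_ring_unit x : v x = 0 -> x \in O.
Proof. by move=> vx; apply: val_ring_ge0; rewrite vx. Qed.

Lemma residueE x (Ox : x \in O) : residue v x = residue_proj (ValRing Ox).
Proof. by rewrite /residue insubT. Qed.

Lemma residueM x y : x \in O -> y \in O ->
  residue v (x * y) = residue v x * residue v y.
Proof.
move=> Ox Oy; have Oxy : x * y \in O by apply: rpredM.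
rewrite !residueE -residue_projM; congr residue_proj.
exact: val_inj.
Qed.

Lemma residueB x y : x \in O -> y \in O ->
  residue v (x - y) = residue v x - residue v y.
Proof.
move=> Ox Oy; have Oxy : x - y \in O by apply: rpredB.
rewrite !residueE; apply: etrans (_ : residue_proj (ValRing Ox - ValRing Oy) = _).
  by congr residue_proj; apply: val_inj.
by rewrite /residue_proj !piE.
Qed.

Lemma residue1 : residue v 1 = 1.
Proof.
have O1 : 1 \in O by apply: rpred1.
by rewrite residueE -residue_proj1; congr residue_proj; apply: val_inj.
Qed.

Lemma residue_eq0 x : x != 0 -> 0 <= v x -> (residue v x == 0) = (v x != 0).
Proof.
move=> x0 vx; rewrite (residueE (val_ring_ge0 vx)) residue_proj_eq0.
by rewrite unfold_in /= (negbTE x0) /= lt_neqAle vx andbT eq_sym.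
Qed.

Lemma residue_unit_neq0 x : x != 0 -> v x = 0 -> residue v x != 0.
Proof. by move=> x0 vx; rewrite residue_eq0 ?vx ?eqxx. Qed.

Lemma residueV x : x != 0 -> v x = 0 -> residue v x^-1 = (residue v x)^-1.
Proof.
move=> x0 vx; apply: (mulfI (residue_unit_neq0 x0 vx)).
rewrite divff ?residue_unit_neq0// -residueM ?divff ?residue1//.
  exact: val_ring_unit.
by apply: val_ring_unit; rewrite valuationV// vx oppr0.
Qed.

Lemma residue_pos x : 0 < v x -> residue v x = 0.
Proof.
have [->|x0] := eqVneq x 0.
  have O0 : 0 \in O by apply: rpred0.
  by rewrite residueE => _; apply/eqP; rewrite residue_proj_eq0 unfold_in eqxx.
by move=> vx; apply/eqP; rewrite residue_eq0// ?gt_eqF// ltW.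
Qed.

Lemma residueN1 : residue v (-1) = -1.
Proof.
have O0 : 0 \in O by apply: rpred0.
have r0 : residue v 0 = 0.
  by rewrite residueE; apply/eqP; rewrite residue_proj_eq0 unfold_in eqxx.
by rewrite -sub0r residueB ?rpred1// residue1 r0 sub0r.
Qed.

Lemma residue_one_sub x : x \in O -> residue v (1 - x) = 1 - residue v x.
Proof. by move=> Ox; rewrite residueB ?rpred1// residue1. Qed.

Lemma residue_neq0_val x : x != 0 -> x \in O -> residue v x != 0 -> v x = 0.
Proof.
move=> x0; rewrite /in_mem /= /val_ring_pred (negbTE x0) /= => vx.
by rewrite residue_eq0// negbK => /eqP.
Qed.

Lemma residue_surj (q : k) : q != 0 ->
  exists u, [/\ u != 0, v u = 0 & residue v u = q].
Proof.
move=> q0; pose a := repr (q : {ideal_quot max_ideal v}).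
have Oa : vr_val a \in O by exact: (valP a).
have aE : residue v (vr_val a) = q.
  rewrite residueE -[RHS]residue_proj_repr; congr residue_proj.
  exact: val_inj.
have a0 : vr_val a != 0.
  apply: contraNneq q0 => a0; rewrite -aE a0 -(subrr 1).
  by rewrite residueB ?rpred1// subrr.
by exists (vr_val a); split=> //; apply: residue_neq0_val; rewrite ?aE.
Qed.

Definition principal_unit p := [/\ p != 0, v p = 0 & residue v p = 1].

Lemma principal_unitV p : principal_unit p -> principal_unit p^-1.
Proof.
move=> [p0 vp rp]; split; first exact: invr_neq0.
  by rewrite valuationV// vp oppr0.
by rewrite residueV// rp invr1.
Qed.

Lemma principal_one_sub x : 0 < v x -> principal_unit (1 - x).
Proof.
move=> vx; have Ox : x \in O by apply/val_ring_ge0/ltW.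
have rx : residue v (1 - x) = 1 by rewrite residue_one_sub// residue_pos// subr0.
have x0 : 1 - x != 0.
  apply/eqP => x1; move: rx; rewrite x1 => /eqP.
  rewrite residue_pos; first by rewrite eq_sym oner_eq0.
  by move: vx; rewrite -(subKr 1 x) x1 subr0 valuation1 ltxx.
split=> //; apply: residue_neq0_val; rewrite ?rx ?oner_eq0//.
by rewrite rpredB ?rpred1.
Qed.

(** The specialization of [x] in the projective line over the residue field,
    with the special points [0], infinity and [1] singled out. *)
Variant place_spec x : Prop :=
| PlaceZero of 0 < v x
| PlaceInfty of v x < 0
| PlaceOne of v x = 0 & residue v x = 1 & 0 < v (1 - x)
| PlaceGeneric of v x = 0 & residue v x != 1 & v (1 - x) = 0.

Lemma placeP x : x != 0 -> x != 1 -> place_spec x.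
Proof.
move=> x0 x1; have u0 := subr1_neq0 x1.
have [vx|vx|vx] := ozmod_sign (v x); [|exact: PlaceZero|exact: PlaceInfty].
have Ou : 1 - x \in O by rewrite rpredB ?rpred1// val_ring_unit.
have ru := residue_one_sub (val_ring_unit vx).
have [rx|rx] := eqVneq (residue v x) 1.
  apply: PlaceOne => //; move: Ou; rewrite /in_mem /= /val_ring_pred (negbTE u0) /=.
  move=> vu; rewrite lt_neqAle vu andbT eq_sym -residue_eq0// ru rx.
  by rewrite subrr.
by apply: PlaceGeneric => //; apply: residue_neq0_val; rewrite // ru subr1_neq0.
Qed.

Lemma valuation_infty_one_sub x : v x < 0 -> x != 0 -> v (1 - x) = v x.
Proof.
move=> vx x0.
have [p0 vp _] : principal_unit (1 - x^-1).
  by apply: principal_one_sub; rewrite valuationV// ozmod_oppr_gt0.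
have -> : 1 - x = - x * (1 - x^-1) by field.
by rewrite valuationM ?oppr_eq0// valuationN vp addr0.
Qed.

End Residue.

(** * The five-term relation for the specialized symbol *)

Section SpecializedFiveTerm.
Variables (F : fieldType) (G : orderedZmodType) (v : valuation F G).
Local Notation k := (residue_field v).
Variables (R : nzRingType) (M : lmodType R).
Variables (rF : F -> R) (rk : k -> R) (h : k -> M) (C : M).
Hypothesis symbol_h : hat_symbol rk h C.
Hypothesis rM : forall x y : F, x != 0 -> y != 0 -> rF (x * y) = rF x * rF y.
Hypothesis rr : forall x : F, x != 0 -> rF x * rF x = 1.
Hypothesis r_unit : forall u : F, u != 0 -> v u = 0 -> rF u = rk (residue v u).
Local Notation s := (rF (-1)).

Definition specialized_symbol (a : F) : M :=
  if v a == 0 then h (residue v a) else C *~ val_sign v a.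
Local Notation T := specialized_symbol.

Lemma specialized_unit a : v a = 0 -> T a = h (residue v a).
Proof. by rewrite /T => ->; rewrite eqxx. Qed.

Lemma specialized_pos a : 0 < v a -> T a = C.
Proof. by move=> va; rewrite /T gt_eqF// /val_sign va. Qed.

Lemma specialized_neg a : v a < 0 -> T a = - C.
Proof. by move=> va; rewrite /T lt_eqF// /val_sign va lt_gtF// mulrNz. Qed.

Let s_residue : s = rk (-1).
Proof. by rewrite r_unit ?oppr_eq0 ?oner_eq0 ?residueN1// valuationN valuation1. Qed.

Let sC : s *: C = C.
Proof. by rewrite s_residue (hat_constZ symbol_h)// oppr_eq0 oner_eq0. Qed.

Lemma specialized1 : T 1 = 0.
Proof. by rewrite specialized_unit ?valuation1// residue1 (hat1 symbol_h). Qed.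

Lemma specialized_mul_principal a p : a != 0 -> principal_unit v p -> T (a * p) = T a.
Proof.
move=> a0 [p0 vp rp]; have vap : v (a * p) = v a by rewrite valuationM// vp addr0.
rewrite /T /val_sign vap; case: eqP => // va.
by rewrite residueM ?val_ring_unit// rp mulr1.
Qed.

Lemma specializedV a : a != 0 -> T a^-1 = - (s *: T a).
Proof.
move=> a0; have vV := valuationV v a0.
have [va|va|va] := ozmod_sign (v a).
- rewrite !specialized_unit ?vV ?va ?oppr0// residueV//.
  by rewrite (hatV symbol_h) ?residue_unit_neq0// s_residue.
- by rewrite specialized_neg ?vV ?ozmod_oppr_lt0// specialized_pos// sC.
- rewrite specialized_pos ?vV ?ozmod_oppr_gt0// specialized_neg//.
  by rewrite scalerN sC opprK.
Qed.

(** At a point specializing to infinity both terms are [- C], and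
    [- 2 C = C]. *)
Lemma specialized_const a : a != 0 -> a != 1 -> T a + s *: T (1 - a) = C.
Proof.
move=> a0 a1; have [va|va|va ra vu|va ra vu] := placeP v a0 a1.
- have [p0 vp rp] := principal_one_sub va.
  by rewrite specialized_pos// specialized_unit// rp (hat1 symbol_h) scaler0 addr0.
- rewrite specialized_neg// specialized_neg ?valuation_infty_one_sub//.
  apply/eqP; rewrite scalerN sC -subr_eq0 -!opprD -mulr2n -mulrSr.
  by rewrite (hat_const3 symbol_h) oppr0.
- by rewrite specialized_unit// ra (hat1 symbol_h) add0r specialized_pos.
- rewrite !specialized_unit// residue_one_sub ?val_ring_unit// s_residue.
  by rewrite (hat_const symbol_h) ?residue_unit_neq0.
Qed.

(** If [x] specializes to [0] then [1 - x] is a principal unit.  The terms with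
    coefficient [rF x] cancel because [T (t w) = T t], and what is left is
    [C - (T y + s T (1 - y))]. *)
Lemma five_term_zero x y : x != 0 -> x != 1 -> y != 0 -> y != 1 -> 0 < v x ->
  five_term rF T x y = 0.
Proof.
move=> x0 x1 y0 y1 vx; rewrite /five_term /five_tail.
have [u0 w0] := (subr1_neq0 x1, subr1_neq0 y1).
have pu := principal_one_sub vx; have [_ vu ru] := pu.
have t0 : y / x != 0 by rewrite mulf_neq0 ?invr_eq0.
have ru1 : rF (1 - x) = 1.
  rewrite r_unit// ru -(mulr1 (rk 1)) -{1}(mulr1 1).
  by rewrite (hat_rM symbol_h) ?oner_eq0// (hat_rr symbol_h) ?oner_eq0// mulr1.
have Tw : T ((1 - x) / (1 - y)) = - (s *: T (1 - y)).
  by rewrite mulrC specialized_mul_principal ?invr_neq0// specializedV.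
have Ttw : T (y / x * ((1 - x) / (1 - y))) = T (y / x).
  rewrite (mulrC (1 - x)) mulrA specialized_mul_principal ?mulf_neq0 ?invr_eq0//.
  have [vy|vy] : 0 < v y \/ v y <= 0.
  - by have [->|vy|vy] := ozmod_sign (v y); [right|left|right; apply: ltW].
  - by apply: specialized_mul_principal => //; apply/principal_unitV/principal_one_sub.
  (* For [v y <= 0] both arguments have negative valuation; for the first one
     use that [(1 - y) / y = 1/y - 1] is in the valuation ring. *)
  pose z := y^-1 - 1; have z0 : z != 0 by rewrite subr_eq0 invr_neq1.
  have zV : z^-1 = y / (1 - y) by rewrite /z; field; rewrite ?y0 ?w0.
  have vz : 0 <= v z.
    have : z \in val_ring_pred v.
      rewrite rpredB ?rpred1// val_ring_ge0// valuationV//.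
      by have := ozmod_leD2l (- v y) _ _ vy; rewrite addr0 addNr.
    by rewrite /in_mem /= /val_ring_pred (negbTE z0).
  have vx' := ozmod_oppr_lt0 vx.
  rewrite mulrAC -zV !specialized_neg//.
    by rewrite valuation_div// ozmod_addr_lt0.
  rewrite valuation_div ?invr_neq0// valuationV// ozmod_addr_lt0//.
  by have := ozmod_leD2l (- v z) _ _ vz; rewrite addr0 addNr.
rewrite Tw Ttw ru1 mulr1 scale1r subrr add0r specialized_pos//.
by rewrite -addrA -opprD specialized_const// subrr.
Qed.

(** The arguments [t] and [t w] lie in the maximal ideal, while [w] is [1 - x]
    up to a principal unit; what is left is [T x + s T (1 - x) - C]. *)
Lemma five_term_generic_zero x y : x != 0 -> x != 1 -> y != 0 -> y != 1 ->
  v x = 0 -> residue v x != 1 -> v (1 - x) = 0 -> 0 < v y ->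
  five_term rF T x y = 0.
Proof.
move=> x0 x1 y0 y1 vx rx vu vy; rewrite /five_term /five_tail.
have [u0 w0] := (subr1_neq0 x1, subr1_neq0 y1).
have pw := principal_unitV (principal_one_sub vy).
have t0 : y / x != 0 by rewrite mulf_neq0 ?invr_eq0.
have rC a : a != 0 -> v a = 0 -> rF a *: C = C.
  by move=> a0 va; rewrite r_unit// (hat_constZ symbol_h) ?residue_unit_neq0.
have Tt : T (y / x) = C by rewrite specialized_pos// valuation_div// vx subr0.
have Tw : T ((1 - x) / (1 - y)) = T (1 - x) by apply: specialized_mul_principal.
have Ttw : T (y / x * ((1 - x) / (1 - y))) = C.
  rewrite mulrA specialized_mul_principal ?(mulf_neq0 t0)//.
  apply: specialized_pos.
  by rewrite valuationM// valuation_div// vx vu subr0 addr0.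
have ru : rF (1 - x) *: T (1 - x) = s *: T (1 - x).
  rewrite specialized_unit// r_unit// (hat_sq symbol_h) ?residue_unit_neq0//.
  by rewrite s_residue.
rewrite Tt Tw Ttw ru -scalerA !rC// subrr add0r (specialized_pos vy).
by rewrite addrAC specialized_const// subrr.
Qed.

Lemma five_term_generic x y : x != 0 -> x != 1 -> y != 0 -> y != 1 ->
  v x = 0 -> residue v x != 1 -> v (1 - x) = 0 ->
  v y = 0 -> residue v y != 1 -> v (1 - y) = 0 ->
  five_term rF T x y = 0.
Proof.
move=> x0 x1 y0 y1 vx rx vu vy ry vw.
have [u0 w0] := (subr1_neq0 x1, subr1_neq0 y1).
have [Ox Oy] := (val_ring_unit vx, val_ring_unit vy).
have v_div a b : a != 0 -> b != 0 -> v a = 0 -> v b = 0 -> v (a / b) = 0.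
  by move=> a0 b0 va vb; rewrite valuation_div// va vb subrr.
have res_div a b : a != 0 -> b != 0 -> v a = 0 -> v b = 0 ->
    residue v (a / b) = residue v a / residue v b.
  move=> a0 b0 va vb; rewrite residueM ?val_ring_unit ?residueV//.
  by rewrite valuationV// vb oppr0.
have xk0 := residue_unit_neq0 x0 vx; have yk0 := residue_unit_neq0 y0 vy.
rewrite -(hat_five symbol_h xk0 rx yk0 ry) /five_term /five_tail.
have vt := v_div _ _ y0 x0 vy vx; have vuw := v_div _ _ u0 w0 vu vw.
have vtw : v (y / x * ((1 - x) / (1 - y))) = 0.
  by rewrite valuationM ?mulf_neq0 ?invr_eq0// vt vuw addr0.
rewrite !specialized_unit// !r_unit//.
rewrite (residueM (val_ring_unit vt) (val_ring_unit vuw)) !res_div//.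
by rewrite !residue_one_sub.
Qed.

Lemma specialized_nonunit a : v a != 0 -> T a = C *~ val_sign v a.
Proof. by move/negbTE=> va; rewrite /T va. Qed.

Lemma specializedN1 : (T (-1) + s *: T (-1)) *+ 2 = 0.
Proof.
have N0 : -1 != 0 :> F by rewrite oppr_eq0 oner_eq0.
by rewrite -{1}(invrN1 F) specializedV// addNr mul0rn.
Qed.

(** Reflection exchanges the points specializing to [0] and [1], and inversion
    those specializing to [0] and infinity; both preserve generic points. *)
Theorem specialized_five_term x y : x != 0 -> x != 1 -> y != 0 -> y != 1 ->
  five_term rF T x y = 0.
Proof.
move=> x0 x1 y0 y1; have [u0 w0] := (subr1_neq0 x1, subr1_neq0 y1).
have [u1 w1] := (subr1_neq1 x0, subr1_neq1 y0).
have [xV0 yV0] := (invr_neq0 x0, invr_neq0 y0).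
have [xV1 yV1] := (invr_neq1 x1, invr_neq1 y1).
have reflect : five_term rF T (1 - x) (1 - y) = 0 -> five_term rF T x y = 0.
  move=> E; have := five_term_reflect rM rr specializedV x0 x1 y0 y1.
  by rewrite !specialized_const// subrr E scaler0 addr0.
have invert : five_term rF T x^-1 y^-1 = 0 -> five_term rF T x y = 0.
  move=> E; have := five_term_inv rM rr specializedV x0 x1 y0 y1.
  by rewrite E scaler0 addr0.
have [vx|vx|vx rx vu|vx rx vu] := placeP v x0 x1.
- exact: five_term_zero.
- by apply/invert/five_term_zero; rewrite // valuationV// ozmod_oppr_gt0.
- exact/reflect/five_term_zero.
have [vy|vy|vy ry vw|vy ry vw] := placeP v y0 y1.
- exact: five_term_generic_zero.
- apply/invert/five_term_generic_zero; rewrite ?valuationV ?vx ?oppr0//.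
  + by rewrite residueV// invr_neq1.
  + have -> : 1 - x^-1 = - (1 - x) / x by field.
    by rewrite valuation_div ?oppr_eq0// valuationN vu vx subr0.
  + exact: ozmod_oppr_gt0.
- apply/reflect/five_term_generic_zero; rewrite ?subKr//.
  by rewrite residue_one_sub ?val_ring_unit// subr1_neq1 ?residue_unit_neq0.
- exact: five_term_generic.
Qed.

End SpecializedFiveTerm.

(** * The specialization homomorphism *)

Lemma five_term_restr (F : fieldType) (R S : nzRingType) (rho : {rmorphism R -> S})
    (M : lmodType S) (r : F -> R) (T : F -> M) x y :
  five_term (r : F -> R) (T : F -> restr_scalars rho M) x y =
  five_term (fun a => rho (r a)) T x y.
Proof. by rewrite /five_term /five_tail -rmorphM. Qed.

Section ResidueMorphism.
Variables (F : fieldType) (G : orderedZmodType) (v : valuation F G).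
Local Notation k := (residue_field v).
Variable rho : {rmorphism RF F -> RF k}.
Hypothesis rho_unit : forall u : F, u != 0 -> v u = 0 ->
  rho (sqc u) = sqc (residue v u).

Lemma rho_surj c : exists r, rho r = c.
Proof.
elim/RF_ind: c => [|_ _ [a <-] [b <-]|q q0].
- by exists 0; exact: raddf0.
- by exists (a - b); exact: raddfB.
- by have [u [u0 vu <-]] := residue_surj q0; exists (sqc u); apply: rho_unit.
Qed.

Lemma rhoM (x y : F) : x != 0 -> y != 0 ->
  rho (sqc (x * y)) = rho (sqc x) * rho (sqc y).
Proof. by move=> x0 y0; rewrite sqcM//; apply: rmorphM. Qed.

Lemma rho_sq (x : F) : x != 0 -> rho (sqc x) * rho (sqc x) = 1.
Proof.
move=> x0; apply: etrans (esym (rmorphM rho _ _)) _.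
by rewrite sqc_sq//; apply: rmorph1.
Qed.

(** This serves the case of two elements in [k], where [C_k] is a generator of
    [RP k].  Every unit of [F] is then principal, so for [x] other than [0] and
    [1] not both [x] and [1 - x] are units. *)
Lemma const_in_image (N : lmodType (RF k)) (C : N)
    (S : {linear RP F -> restr_scalars rho N}) :
  has_card k 2 -> (has_card F 2 -> S (RC F) = C) ->
  (forall a, a != 0 -> v a != 0 -> S (rp a) = C *~ val_sign v a) ->
  exists m, S m = C.
Proof.
move=> k2 S_RC S_nonunit; have [F2|F2] := boolP (has_card F 2).
  by exists (RC F); apply: S_RC.
have [x [x0 vx]] : exists x : F, x != 0 /\ v x != 0.
  have [x [x0 x1]] := not_card2 F2; have u0 := subr1_neq0 x1.
  have [vx|vx|vx rx vu|vx rx vu] := placeP v x0 x1.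
  - by exists x; rewrite gt_eqF.
  - by exists x; rewrite lt_eqF.
  - by exists (1 - x); rewrite gt_eqF.
  - by have := card2_eq1 k2 (residue_unit_neq0 x0 vx) => /eqP; rewrite (negbTE rx).
have [vx0|vx0|vx0] := ozmod_sign (v x); first by rewrite vx0 eqxx in vx.
  exists (rp x); apply: etrans (S_nonunit x x0 vx) _.
  by rewrite /val_sign vx0.
exists (- rp x); apply: etrans (raddfN S (rp x)) _.
apply: etrans (congr1 (fun z : N => - z) (S_nonunit x x0 vx)) _.
by rewrite /val_sign vx0 lt_gtF// mulrNz opprK.
Qed.

Lemma residue_generation (N : lmodType (RF k)) (pi : {linear RP k -> N})
    (S : {linear RP F -> restr_scalars rho N}) :
  (forall q, exists m, pi m = q) ->
  (forall u, u != 0 -> v u = 0 -> S (rp u) = pi (rp (residue v u))) ->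
  (has_card k 2 -> exists m, S m = pi (RC k)) ->
  forall q : restr_scalars rho N, exists m, S m = q.
Proof.
move=> pi_surj S_unit S_const q; have [m <-] := pi_surj q.
have S_scale r x n : S x = pi n -> exists x', S x' = pi (rho r *: n).
  move=> xn; exists (r *: x); apply: etrans (linearZ_LR S r x) _.
  apply: etrans (congr1 (fun z : N => rho r *: z) xn) _.
  exact: esym (linearZ_LR pi (rho r) n).
elim/RP_ind: m => [|m1 m2 [a am] [b bn]|c x x0|k2 c].
- by exists 0; apply: etrans (raddf0 S) (esym (raddf0 pi)).
- exists (a + b); apply: etrans (raddfD S a b) _.
  apply: etrans (congr2 (fun y z : N => y + z) am bn) _.
  exact: esym (raddfD pi m1 m2).
- have [[r <-] [u [u0 vu <-]]] := (rho_surj c, residue_surj x0).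
  exact: S_scale (S_unit u u0 vu).
- have [[r <-] [a aC]] := (rho_surj c, S_const k2).
  exact: S_scale aC.
Qed.

End ResidueMorphism.

Theorem corollary4p10 (F : fieldType) (G : orderedZmodType)
    (v : valuation F G)
    (rho : {rmorphism RF F -> RF (residue_field v)})
    (rho_unit : forall u : F, u != 0 -> v u = 0 ->
       rho (sqc u) = sqc (residue v u)) :
  linear (fun m : restr_scalars rho (RP (residue_field v)) =>
            RPhat_proj (residue_field v) m
              : restr_scalars rho (RPhat (residue_field v)))
  /\ exists S : {linear RP F -> restr_scalars rho (RPhat (residue_field v))},
    [/\ is_specialization S,
        (forall y : restr_scalars rho (RPhat (residue_field v)),
           exists x : RP F, S x = y)
      & forall S' : {linear RP F -> restr_scalars rho (RPhat (residue_field v))},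
          is_specialization S' -> S' =1 S].
Proof.
split; first by move=> r a b; exact: (linearP (RPhat_proj _) (rho r) a b).
pose T := specialized_symbol (@rphat (residue_field v)) (RChat (residue_field v)).
have sym := RPhat_symbol (residue_field v).
have rM := rhoM rho; have rr := rho_sq rho.
have [||||S [S_rp S_RC]] := @RP_lift F (restr_scalars rho (RPhat (residue_field v)))
  T (RChat (residue_field v)).
- exact: specialized1 sym.
- move=> x y x0 x1 y0 y1; apply: etrans (five_term_restr rho (@sqc F) T x y) _.
  exact: (specialized_five_term sym rM rr rho_unit).
- exact: (specializedN1 sym rho_unit).
- exact: hat_const3 sym.
have S_unit a : a != 0 -> v a = 0 -> S (rp a) = rphat (residue v a).
  by move=> a0 va; apply: etrans (S_rp a a0) _; apply: specialized_unit.
have S_nonunit a : a != 0 -> v a != 0 ->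
    S (rp a) = RChat (residue_field v) *~ val_sign v a.
  by move=> a0 va; apply: etrans (S_rp a a0) _; apply: specialized_nonunit.
exists S; split=> [//||S' [S'_unit S'_nonunit S'_RC]].
- apply: (residue_generation rho_unit (pi := RPhat_proj (residue_field v)))
    => [q|u u0 vu|k2].
  + by exists (repr (q : {ideal_quot span_closed _})); apply: qproj_repr.
  + exact: S_unit.
  + exact: const_in_image k2 S_RC S_nonunit.
- apply: RP_linear_ext => [a a0|F2]; last first.
    by apply: etrans (S'_RC F2) (esym (S_RC F2)).
  have [va|va] := eqVneq (v a) 0.
    exact: etrans (S'_unit a a0 va) (esym (S_unit a a0 va)).
  exact: etrans (S'_nonunit a a0 va) (esym (S_nonunit a a0 va)).
Qed.
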